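(* Let $G$ be a countable graph every finite subgraph of which is a circle graph. Then $G$ is a circle graph.
   Context: A chord of the unit circle $\mathbb{S}^1\subset\mathbb{R}^2$ is a line segment (including its endpoints) joining two distinct points of $\mathbb{S}^1$. A circle graph is a (finite or infinite) graph isomorphic to the intersection graph of a set of chords of $\mathbb{S}^1$: the graph whose vertices are these chords, in which two distinct chords are adjacent if and only if they intersect (either at a point of $\mathbb{S}^1$ or at a point inside it). Subgraph has its usual graph-theoretic meaning (not necessarily induced). *)

(* Defs.v *)
From mathcomp Require Import all_boot all_order all_algebra.
From mathcomp Require Import all_classical all_reals all_analysis.

Set Implicit Arguments.
Unset Strict Implicit.
Unset Printing Implicit Defensive.

Import Order.TTheory GRing.Theory Num.Theory numFieldNormedType.Exports.
Local Open Scope classical_set_scope.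
Local Open Scope ring_scope.

(* Simple graphs whose vertices form a subset of an ambient type [T], so that a
   graph and its subgraphs live over the same type. *)
Record graph (T : Type) := Graph {
  vertices : set T;
  adj : T -> T -> Prop;
  adj_sym : forall x y, adj x y -> adj y x;
  adj_irrefl : forall x, ~ adj x x;
  adj_vertices : forall x y, adj x y -> vertices x /\ vertices y
}.

Definition subgraph (T : Type) (H G : graph T) : Prop :=
  vertices H `<=` vertices G /\ (forall x y, adj H x y -> adj G x y).

(* [U] is pointed because the isomorphism is given by a function defined on all
   of [T], of which only the values on [vertices G] matter. *)
Definition isomorphic (T : Type) (U : pointedType) (G : graph T) (H : graph U)
    : Prop :=
  exists f : T -> U, set_bij (vertices G) (vertices H) f /\
    forall x y, vertices G x -> vertices G y -> (adj G x y <-> adj H (f x) (f y)).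

Section IntersectionGraph.
Variables (P : Type) (F : set (set P)).

Definition intersection_adj (A B : set P) : Prop :=
  [/\ F A, F B, A <> B & A `&` B !=set0].

Lemma intersection_adj_sym A B : intersection_adj A B -> intersection_adj B A.
Proof. by case=> FA FB AB; rewrite setIC => AB0; split=> // /esym. Qed.

Lemma intersection_adj_irrefl A : ~ intersection_adj A A.
Proof. by case=> _ _ /(_ erefl). Qed.

Lemma intersection_adj_vertices A B : intersection_adj A B -> F A /\ F B.
Proof. by case. Qed.

Definition intersection_graph : graph (set P) :=
  Graph intersection_adj_sym intersection_adj_irrefl intersection_adj_vertices.

End IntersectionGraph.

Section CircleGraph.
Variable R : realType.

Definition unit_circle : set (R * R) := [set p | p.1 ^+ 2 + p.2 ^+ 2 = 1].

Definition segment (p q : R * R) : set (R * R) :=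
  [set (1 - t) *: p + t *: q | t in `[0, 1]].

Definition is_chord (c : set (R * R)) : Prop :=
  exists p q, [/\ unit_circle p, unit_circle q, p <> q & c = segment p q].

Definition circle_graph (T : Type) (G : graph T) : Prop :=
  exists S : set (set (R * R)),
    S `<=` is_chord /\ isomorphic G (intersection_graph S).

End CircleGraph.

(* Main.v *)
Require Import Defs.
From mathcomp Require Import all_boot all_order all_algebra.
From mathcomp Require Import all_classical all_reals all_analysis.
From mathcomp Require Import ring lra.

(* A point of the circle is given by homogeneous coordinates of its stereographic
   parameter, so that the circle, cut open at the pole, is ordered by the sign of
   [det]. Two chords meet iff the product of the four determinants between their
   endpoints is nonpositive, hence a graph is a circle graph iff a certain sign
   pattern, involving only two vertices at a time, is realized. The orders of the
   endpoints obtained from representations of the finite induced subgraphs converge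
   along an ultrafilter on [nat] to a total preorder on the endpoints of all the
   vertices. Being countable, this preorder embeds in the real line, and therefore
   in the circle; each pair of vertices has the sign pattern it has in some
   finite representation. *)

Set Implicit Arguments.
Unset Strict Implicit.
Unset Printing Implicit Defensive.

Import Order.TTheory GRing.Theory Num.Theory numFieldNormedType.Exports.
Local Open Scope classical_set_scope.
Local Open Scope ring_scope.

(** * Stereographic coordinates on the circle *)

Section Chords.
Variable R : realType.
Implicit Types p q r s u v w z : R * R.

Definition det u v : R := u.1 * v.2 - u.2 * v.1.

(** Twice the signed area of the triangle [p q r]; its sign tells the side of the line [p q] on
    which [r] lies. *)
Definition orient p q r : R :=
  (q.1 - p.1) * (r.2 - p.2) - (q.2 - p.2) * (r.1 - p.1).

(* Normalized homogeneous coordinates: [u.1 = 0] is the pole [(-1, 0)], the last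
   point of the order [0 <= det u v]. *)
Definition half_plane u : Prop := 0 < u.1 \/ u.1 = 0 /\ 0 < u.2.

Definition sqnorm u : R := u.1 ^+ 2 + u.2 ^+ 2.

(** With [u] read as a complex number this is [u^2 / |u|^2]: the angle of [u] is doubled, so the
    half plane covers the circle once. *)
Definition circle_point u : R * R :=
  ((u.1 ^+ 2 - u.2 ^+ 2) / sqnorm u, 2 * u.1 * u.2 / sqnorm u).

Lemma sqnorm_gt0 u : half_plane u -> 0 < sqnorm u.
Proof. by rewrite /sqnorm; case=> [?|[-> ?]]; nra. Qed.

Lemma sqdist_gt0 p q : p <> q -> 0 < (q.1 - p.1) ^+ 2 + (q.2 - p.2) ^+ 2.
Proof.
case: p q => [p1 p2] [q1 q2] /= neq.
rewrite lt_neqAle addr_ge0 ?sqr_ge0// andbT eq_sym paddr_eq0 ?sqr_ge0//.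
rewrite !sqrf_eq0 !subr_eq0; apply/negP => /andP[/eqP e1 /eqP e2].
by apply: neq; rewrite e1 e2.
Qed.

(** The identity [e] settles the case where [v] is not the pole. If [v] is the pole, [0 <= det v w]
    forces [w] to be the pole too. *)
Lemma det_ge0_trans u v w : half_plane u -> half_plane v -> half_plane w ->
  0 <= det u v -> 0 <= det v w -> 0 <= det u w.
Proof.
rewrite /det => hu hv hw uv vw.
have u1 : 0 <= u.1 by case: hu => [/ltW|[->]].
have w1 : 0 <= w.1 by case: hw => [/ltW|[->]].
have e : v.1 * (u.1 * w.2 - u.2 * w.1) =
  w.1 * (u.1 * v.2 - u.2 * v.1) + u.1 * (v.1 * w.2 - v.2 * w.1) by ring.
case: hv => [v1|[v1 v2]].
  by rewrite -(pmulr_rge0 _ v1) e addr_ge0// mulr_ge0.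
case: hw => [hw|[-> w2]]; first by exfalso; nra.
by nra.
Qed.

Lemma unit_circle_circle_point u : half_plane u -> unit_circle (circle_point u).
Proof.
move=> /sqnorm_gt0 /lt0r_neq0; rewrite /unit_circle /circle_point /sqnorm /= => n0.
by field.
Qed.

Lemma unit_circleP p : unit_circle p ->
  exists u, half_plane u /\ circle_point u = p.
Proof.
case: p => x y; rewrite /unit_circle /= => e.
have [x1|x1] := eqVneq x (-1).
  exists (0, 1); split; first by right.
  have y0 : y = 0 by apply/eqP; rewrite -sqrf_eq0; apply/eqP; move: e; rewrite x1; lra.
  by rewrite /circle_point /sqnorm /= x1 y0; congr pair; field.
have x0 : 1 + x != 0 by rewrite addrC -subr_eq0 opprK in x1 *.
have x2 : 0 < 1 + x by rewrite lt_neqAle eq_sym x0 /=; nra.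
(* Half-angle formula: the point at angle [a] has parameter [tan (a / 2) = y / (1 + x)]. *)
exists (1 + x, y); split; first by left.
rewrite /circle_point /sqnorm /=.
have -> : (1 + x) ^+ 2 + y ^+ 2 = 2 * (1 + x) by rewrite -[y ^+ 2](addKr (x ^+ 2)) e; ring.
have -> : y ^+ 2 = 1 - x ^+ 2 by rewrite -e; ring.
by congr pair; field; rewrite x0.
Qed.

(** The squared distance of the two points is a positive multiple of [det u v ^+ 2]. *)
Lemma circle_point_eq u v : half_plane u -> half_plane v ->
  circle_point u = circle_point v <-> det u v = 0.
Proof.
move=> hu hv.
have nu := lt0r_neq0 (sqnorm_gt0 hu); have nv := lt0r_neq0 (sqnorm_gt0 hv).
have e : ((circle_point v).1 - (circle_point u).1) ^+ 2
    + ((circle_point v).2 - (circle_point u).2) ^+ 2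
    = 4 * det u v ^+ 2 / (sqnorm u * sqnorm v).
  by move: nu nv; rewrite /circle_point /sqnorm /det /= => nu nv; field; rewrite nu nv.
split=> [E|d0].
  move: e; rewrite E !subrr expr0n/= addr0 => /esym/eqP.
  rewrite !mulf_eq0 invr_eq0 mulf_eq0 (negbTE nu) (negbTE nv) !orbF pnatr_eq0/=.
  by case/orP => /eqP.
apply: contrapT => /sqdist_gt0; rewrite e d0 expr0n/= mulr0 mul0r.
by rewrite ltxx.
Qed.

Lemma orient_circle_point u v w :
  half_plane u -> half_plane v -> half_plane w ->
  orient (circle_point u) (circle_point v) (circle_point w) =
  4 / (sqnorm u * sqnorm v * sqnorm w) * (det u v * det u w * det v w).
Proof.
move=> /sqnorm_gt0/lt0r_neq0 nu /sqnorm_gt0/lt0r_neq0 nv /sqnorm_gt0/lt0r_neq0 nw.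
move: nu nv nw; rewrite /orient /circle_point /sqnorm /det /= => nu nv nw.
by field; rewrite nu nv nw.
Qed.

(** * Intersection and equality of chords *)

Lemma convex_pairE p q (t : R) : (1 - t) *: p + t *: q =
  ((1 - t) * p.1 + t * q.1, (1 - t) * p.2 + t * q.2).
Proof. by []. Qed.

(** [orient p q] is affine along the segment [r s], so it has a zero there exactly when its values
    at [r] and [s] do not share a strict sign. Such a zero lies on the line [p q] and in the closed
    disc, which meet in the segment [p q]. *)
Lemma segment_meet p q r s : unit_circle p -> unit_circle q ->
  unit_circle r -> unit_circle s -> p <> q ->
  segment p q `&` segment r s !=set0 <-> orient p q r * orient p q s <= 0.
Proof.
rewrite /unit_circle /= => up uq ur us pq.
set a := orient p q r; set b := orient p q s.
have lin t : orient p q ((1 - t) *: r + t *: s) = (1 - t) * a + t * b.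
  by rewrite convex_pairE /a /b /orient /=; ring.
split=> [[_ [[k k01 <-] [t t01 e]]]|ab].
  have : (1 - t) * a + t * b = 0.
    by rewrite -lin e convex_pairE /orient /=; ring.
  move: t01; rewrite /= in_itv /= => /andP[t0 t1] z.
  rewrite leNgt; apply/negP => ab.
  have ab0 := gt_eqF ab.
  have : (1 - t) * a ^+ 2 + t * (a * b) = 0 by rewrite -(mulr0 a) -z; ring.
  have h1 : 0 <= (1 - t) * a ^+ 2 by rewrite mulr_ge0 ?sqr_ge0 ?subr_ge0.
  have h2 : 0 <= t * (a * b) by exact: mulr_ge0 (ltW ab).
  move/eqP; rewrite paddr_eq0//.
  rewrite [in X in _ && X]mulf_eq0 ab0 orbF => /andP[/[swap]/eqP->].
  by rewrite subr0 mul1r sqrf_eq0 => /eqP a0; rewrite a0 mul0r eqxx in ab0.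
have [t t01 z] : exists2 t, 0 <= t <= 1 & (1 - t) * a + t * b = 0.
  have [ab0|ab0] := eqVneq a b.
    have a0 : a = 0.
      by apply/eqP; rewrite -sqrf_eq0 eq_le sqr_ge0 andbT expr2 {2}ab0.
    by exists 0; rewrite ?lexx ?ler01// -ab0 a0 !mulr0 addr0.
  have ab1 : a - b != 0 by rewrite subr_eq0.
  exists (a / (a - b)); last by field.
  have ab2 : 0 < (a - b) ^+ 2 by rewrite lt0r sqrf_eq0 ab1 sqr_ge0.
  have -> : a / (a - b) = a * (a - b) / (a - b) ^+ 2 by field.
  by rewrite divr_ge0 ?sqr_ge0 ?ler_pdivrMr//=; nra.
rewrite -lin in z; set x := _ + _ in z.
have x1 : x.1 ^+ 2 + x.2 ^+ 2 <= 1.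
  have -> : x.1 ^+ 2 + x.2 ^+ 2 = (1 - t) * (r.1 ^+ 2 + r.2 ^+ 2)
     + t * (s.1 ^+ 2 + s.2 ^+ 2) - t * (1 - t) * ((r.1 - s.1) ^+ 2 + (r.2 - s.2) ^+ 2).
    by rewrite /x convex_pairE /=; ring.
  case/andP: t01 => t0 t1.
  rewrite ur us !mulr1 subrK gerBl mulr_ge0 ?addr_ge0 ?sqr_ge0 ?mulr_ge0 ?subr_ge0//.
have n0 := sqdist_gt0 pq; set n := _ + _ in n0.
have nn := lt0r_neq0 n0.
(* The parameter of the orthogonal projection of [x] to the line [p q]; since [orient p q x]
   vanishes, [x] is its own projection. *)
pose k := ((x.1 - p.1) * (q.1 - p.1) + (x.2 - p.2) * (q.2 - p.2)) / n.
have xk : (1 - k) *: p + k *: q = x.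
  apply/eqP; rewrite [x]surjective_pairing convex_pairE xpair_eqE.
  have kn : k * n = (x.1 - p.1) * (q.1 - p.1) + (x.2 - p.2) * (q.2 - p.2).
    by rewrite divfK.
  have e1 : n * ((1 - k) * p.1 + k * q.1 - x.1) = (q.2 - p.2) * orient p q x.
    have -> : n * ((1 - k) * p.1 + k * q.1 - x.1) =
      k * n * (q.1 - p.1) - n * (x.1 - p.1) by ring.
    by rewrite kn /n /orient; ring.
  have e2 : n * ((1 - k) * p.2 + k * q.2 - x.2) = - (q.1 - p.1) * orient p q x.
    have -> : n * ((1 - k) * p.2 + k * q.2 - x.2) =
      k * n * (q.2 - p.2) - n * (x.2 - p.2) by ring.
    by rewrite kn /n /orient; ring.
  move: e1 e2; rewrite z !mulr0 => /eqP e1 /eqP e2; move: e1 e2.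
  by rewrite !mulf_eq0 (negbTE nn)/= !subr_eq0 => -> ->.
exists x; split; last by exists t => //=; rewrite in_itv.
exists k => //=; rewrite in_itv/=.
(* The power of the point [x]: as [x] lies in the disc, [k * (1 - k)] is nonnegative, so [k] lies
   between 0 and 1. *)
have kk : x.1 ^+ 2 + x.2 ^+ 2 = 1 - k * (1 - k) * n.
  transitivity ((1 - k) * (p.1 ^+ 2 + p.2 ^+ 2)
      + k * (q.1 ^+ 2 + q.2 ^+ 2) - k * (1 - k) * n).
    by rewrite -xk convex_pairE /n /=; ring.
  by rewrite up uq; ring.
have : 0 <= k * (1 - k) by rewrite -(pmulr_lge0 _ n0); lra.
by move=> ?; apply/andP; split; nra.
Qed.

(** Strict convexity of the disc: the point of parameter [t] has squared norm [1 - t * (1 - t) * n],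
    which is 1 only for [t = 0] or [t = 1]. *)
Lemma segment_unit_circle p q r : unit_circle p -> unit_circle q ->
  unit_circle r -> segment p q r -> r = p \/ r = q.
Proof.
rewrite /unit_circle /= => up uq ur [t _ e].
have [pq|/eqP pq] := eqVneq p q.
  by right; rewrite -e pq -scalerDl subrK scale1r.
have n0 := lt0r_neq0 (sqdist_gt0 pq); set n := _ + _ in n0.
have : t * (1 - t) * n = 0.
  apply: (@addrI _ (r.1 ^+ 2 + r.2 ^+ 2)).
  transitivity ((1 - t) * (p.1 ^+ 2 + p.2 ^+ 2) + t * (q.1 ^+ 2 + q.2 ^+ 2)).
    by rewrite -e convex_pairE /n /=; ring.
  by rewrite up uq ur; ring.
move/eqP; rewrite !mulf_eq0 (negbTE n0) orbF subr_eq0 => /orP[]/eqP t0.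
  by left; rewrite -e t0 subr0 scale1r scale0r addr0.
by right; rewrite -e -t0 subrr scale1r scale0r add0r.
Qed.

Lemma segmentC p q : segment p q = segment q p.
Proof.
by rewrite eqEsubset; split=> _ [t /= t01 <-]; exists (1 - t);
  rewrite ?subKr 1?addrC//; move: t01; rewrite /= !in_itv/= => /andP[? ?];
  apply/andP; split; lra.
Qed.

Lemma segment_left p q : segment p q p.
Proof.
by exists 0; rewrite /= ?in_itv/= ?lexx ?ler01// subr0 scale1r scale0r addr0.
Qed.

Lemma segment_inj p q r s : unit_circle p -> unit_circle q ->
  unit_circle r -> unit_circle s -> r <> s ->
  segment p q = segment r s -> p = r /\ q = s \/ p = s /\ q = r.
Proof.
move=> up uq ur us rs e.
have hr : segment p q r by rewrite e; exact: segment_left.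
have hs : segment p q s by rewrite e segmentC; exact: segment_left.
case: (segment_unit_circle up uq ur hr) => er;
case: (segment_unit_circle up uq us hs) => es; subst;
  by [exfalso; apply: rs | left | right].
Qed.

Definition chord u v := segment (circle_point u) (circle_point v).

(** Each of the two orientations contains the factor [det u v]; in their product it is squared and
    does not affect the sign. *)
Lemma chord_meet u v w z : half_plane u -> half_plane v -> half_plane w ->
  half_plane z -> det u v != 0 ->
  chord u v `&` chord w z !=set0 <->
  det u w * det u z * (det v w * det v z) <= 0.
Proof.
move=> hu hv hw hz d0.
rewrite segment_meet; try exact: unit_circle_circle_point; last first.
  by move=> /(circle_point_eq hu hv) /eqP; rewrite (negbTE d0).
rewrite !orient_circle_point//.
have nu := sqnorm_gt0 hu; have nv := sqnorm_gt0 hv.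
have nw := sqnorm_gt0 hw; have nz := sqnorm_gt0 hz.
set a := 4 / _; set b := 4 / _.
have a0 : 0 < a by rewrite divr_gt0 ?mulr_gt0.
have b0 : 0 < b by rewrite divr_gt0 ?mulr_gt0.
have -> : a * (det u v * det u w * det v w) * (b * (det u v * det u z * det v z)) =
  (a * b * det u v ^+ 2) * (det u w * det u z * (det v w * det v z)) by ring.
have d2 : 0 < det u v ^+ 2 by rewrite lt0r sqrf_eq0 d0 sqr_ge0.
by rewrite pmulr_rle0// (mulr_gt0 (mulr_gt0 a0 b0) d2).
Qed.

Lemma is_chordP c : is_chord c <-> exists u v,
  [/\ half_plane u, half_plane v, det u v != 0 & c = chord u v].
Proof.
split=> [[p [q [/unit_circleP[u [hu <-]] /unit_circleP[v [hv <-]] uv ->]]]|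
         [u [v [hu hv d0 ->]]]].
  by exists u, v; split=> //; apply/eqP => /(circle_point_eq hu hv).
exists (circle_point u), (circle_point v); split=> //;
  try exact: unit_circle_circle_point.
by move=> /(circle_point_eq hu hv) /eqP; rewrite (negbTE d0).
Qed.

Lemma chord_eq u v w z : half_plane u -> half_plane v -> half_plane w ->
  half_plane z -> det w z != 0 ->
  chord u v = chord w z <->
  det u w = 0 /\ det v z = 0 \/ det u z = 0 /\ det v w = 0.
Proof.
move=> hu hv hw hz d0.
split.
  move/segment_inj => []; try exact: unit_circle_circle_point.
  - by move=> /(circle_point_eq hw hz) /eqP; rewrite (negbTE d0).
  - by move=> [/(circle_point_eq hu hw) ? /(circle_point_eq hv hz) ?]; left.
  - by move=> [/(circle_point_eq hu hz) ? /(circle_point_eq hv hw) ?]; right.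
move=> [[/(circle_point_eq hu hw) e1 /(circle_point_eq hv hz) e2]|
        [/(circle_point_eq hu hz) e1 /(circle_point_eq hv hw) e2]];
  by rewrite /chord e1 e2 // segmentC.
Qed.

End Chords.

(** * Embedding a countable total preorder in the real line *)

Lemma countable_preorder_embedding (R : realType) (X : Type) (D : set X)
    (le : X -> X -> Prop) :
  countable D -> (forall x y, le x y \/ le y x) ->
  (forall x y z, le x y -> le y z -> le x z) ->
  exists f : X -> R, forall x y, D x -> D y -> le x y <-> f x <= f y.
Proof.
move=> /pcard_injP[e einj] total trans.
(* [x] is sent to the sum of 2^-(e z) over the [z] strictly below [x]. *)
pose below x n := exists z, [/\ D z, e z = n & ~ le x z].
pose u x n : R := if `[< below x n >] then 2^-1 ^+ n else 0.
have u_mono x y n : le x y -> u x n <= u y n.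
  move=> xy; rewrite /u; case: asboolP => [[z [Dz zn xz]]|_].
    case: asboolP => // -[]; exists z; split=> // yz.
    by apply: xz; exact: trans yz.
  by case: asboolP.
have u_ge0 x n : 0 <= u x n by rewrite /u; case: asboolP.
have u_cvg x : cvgn (series (u x)).
  apply: (@series_le_cvg _ _ (geometric 1 2^-1)) => [//|n|n|] /=.
  - by rewrite mul1r exprn_ge0.
  - by rewrite mul1r /u; case: asboolP.
  - by apply: is_cvg_geometric_series; rewrite ger0_norm// invf_lt1// ltr1n.
exists (fun x => limn (series (u x))) => x y Dx Dy.
split=> [xy|]; first by apply: lim_series_le => // n; exact: u_mono.
apply: contraPP => yx; apply/negP; rewrite -ltNge -subr_gt0.
have {yx}[xy yx] : le y x /\ ~ le x y by case: (total x y).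
rewrite -lim_seriesB//; set v := u x - u y.
have v_ge0 n : 0 <= v n by rewrite subr_ge0 u_mono.
(* Here [y] is strictly below [x], so the term of index [e y] is counted for [x]; it is not counted
   for [y], since by injectivity of [e] only [y] itself has this index. *)
have vy : 0 < v (e y).
  have uy0 : u y (e y) = 0.
    rewrite /u; case: asboolP => // -[z [Dz zy []]].
    have -> : z = y by apply: einj; rewrite ?inE.
    by case: (total y y).
  rewrite -[v _]/(u x (e y) - u y (e y)) uy0 subr0 /u asboolT ?exprn_gt0//.
  by exists y.
apply: (@lt_le_trans _ _ (series v (e y).+1)).
  by rewrite /series/= big_nat_recr//= ltr_wpDl ?sumr_ge0.
have v_mono : {homo series v : m n / (m <= n)%N >-> m <= n}.
  by apply: nondecreasing_series => n _ _; exact: v_ge0.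
by apply: (nondecreasing_cvgn_le v_mono); exact: is_cvg_seriesB.
Qed.

(** * Circle graphs as sign patterns of determinants *)

Section Encoding.
Variables (R : realType) (T : Type).
Implicit Types (G H : graph T) (d : T * bool -> T * bool -> R).

(* [d (v, b) (w, c)] compares the endpoint [b] of the chord of [v] with the
   endpoint [c] of the chord of [w]; the first clause for [v <> w] says that the
   two chords are distinct. *)
Definition encodes G d : Prop :=
  (forall v, vertices G v -> d (v, false) (v, true) != 0) /\
  forall v w, vertices G v -> vertices G w -> v <> w ->
    ~ (d (v, false) (w, false) = 0 /\ d (v, true) (w, true) = 0 \/
       d (v, false) (w, true) = 0 /\ d (v, true) (w, false) = 0) /\
    (adj G v w <-> d (v, false) (w, false) * d (v, false) (w, true) *
                   (d (v, true) (w, false) * d (v, true) (w, true)) <= 0).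

(** A representation is the same as a choice of endpoints: [chord_eq] expresses that distinct
    vertices get distinct chords, and [chord_meet] expresses adjacency. *)
Lemma circle_graphP G : circle_graph R G <->
  exists P : T * bool -> R * R, (forall x, half_plane (P x)) /\
    encodes G (fun x y => det (P x) (P y)).
Proof.
split=> [[S [Schord [f [[fS finj _] fadj]]]]|[P [hP [d0 dP]]]].
  have /choice[Q hQ] v : exists u : (R * R) * (R * R), [/\ half_plane u.1,
      half_plane u.2 & vertices G v ->
      det u.1 u.2 != 0 /\ f v = chord u.1 u.2].
    have [Vv|nVv] := pselect (vertices G v).
      by have /is_chordP[u1 [u2 [? ? ? ?]]] := Schord _ (fS _ Vv); exists (u1, u2).
    (* An arbitrary half-plane value outside [vertices G]. *)
    by exists ((1, 0), (1, 0)); split=> //; left; exact: ltr01.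
  exists (fun x => if x.2 then (Q x.1).2 else (Q x.1).1); split.
    by case=> v [] /=; case: (hQ v).
  split=> [v Vv /=|v w Vv Vw vw /=]; first by case: (hQ v) => _ _ /(_ Vv)[].
  have [hv1 hv2 /(_ Vv)[dv fv]] := hQ v.
  have [hw1 hw2 /(_ Vw)[dw fw]] := hQ w.
  have fvw : f v <> f w by move=> /(finj _ _ (mem_set Vv) (mem_set Vw)).
  split; first by rewrite -chord_eq// -fv -fw.
  rewrite fadj// -chord_meet// -fv -fw.
  by split=> [[]//|?]; split=> //; exact: fS.
pose c v := chord (P (v, false)) (P (v, true)).
exists (c @` vertices G); split.
  move=> _ [v Vv <-]; apply/is_chordP; exists (P (v, false)), (P (v, true)).
  by split=> //; exact: d0.
have cinj v w : vertices G v -> vertices G w -> c v = c w -> v = w.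
  move=> Vv Vw; apply: contraPP => /(dP _ _ Vv Vw)[+ _].
  by rewrite -chord_eq//; exact: d0.
exists c; split.
  split=> [v Vv|v w|_ [v Vv <-]]; [by exists v | | by exists v].
  by rewrite !inE; exact: cinj.
move=> v w Vv Vw; have [<-|vw] := pselect (v = w).
  by split=> [h|[_ _ /(_ erefl)]//]; case: (adj_irrefl h).
have [_ ->] := dP _ _ Vv Vw vw.
rewrite -chord_meet//; last exact: d0.
split=> [cvw|[]//]; split=> //.
by move/(cinj _ _ Vv Vw).
Qed.

(** The conditions in [encodes] depend only on signs and on two vertices at a time, so the graph [H]
    that verifies them may vary with the pair. *)
Lemma encodes_sg G d :
  (forall v w, vertices G v -> vertices G w -> exists H dH,
    [/\ encodes H dH, vertices H v, vertices H w,
       (adj H v w <-> adj G v w) &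
       forall b c, Num.sg (dH (v, b) (w, c)) = Num.sg (d (v, b) (w, c))]) ->
  encodes G d.
Proof.
move=> loc; split=> [v Vv|v w Vv Vw vw].
  have [H [dH [[H0 _] Hv _ _ sg]]] := loc _ _ Vv Vv.
  by rewrite -sgr_eq0 -sg sgr_eq0 H0.
have [H [dH [[_ HP] Hv Hw <- sg]]] := loc _ _ Vv Vw.
have d0 b c : d (v, b) (w, c) = 0 <-> dH (v, b) (w, c) = 0.
  have e : (d (v, b) (w, c) == 0) = (dH (v, b) (w, c) == 0).
    by rewrite -[LHS]sgr_eq0 -sg sgr_eq0.
  by split=> /eqP; [rewrite e | rewrite -e] => /eqP.
have [? ->] := HP _ _ Hv Hw vw; split; first by rewrite !d0.
by rewrite -sgr_le0 !sgrM !sg -!sgrM sgr_le0.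
Qed.

Definition induced_adj G (A : set T) v w := [/\ A v, A w & adj G v w].

Lemma induced_adj_sym G A v w : induced_adj G A v w -> induced_adj G A w v.
Proof. by case=> Av Aw vw; split=> //; exact: adj_sym. Qed.

Lemma induced_adj_irrefl G A v : ~ induced_adj G A v v.
Proof. by case=> _ _ h; exact: adj_irrefl h. Qed.

Lemma induced_adj_vertices G A v w : induced_adj G A v w ->
  (vertices G `&` A) v /\ (vertices G `&` A) w.
Proof. by case=> Av Aw vw; have [Gv Gw] := adj_vertices vw. Qed.

Definition induced G A : graph T := Graph (@induced_adj_sym G A)
  (@induced_adj_irrefl G A) (@induced_adj_vertices G A).

Lemma induced_subgraph G A : subgraph (induced G A) G.
Proof. by split=> [v []|v w []]. Qed.

End Encoding.

(** * Passage to the limit along an ultrafilter *)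

Lemma sgr_eq_of_ge0 (R : realType) (a b : R) :
  (0 <= a <-> 0 <= b) -> (0 <= - a <-> 0 <= - b) -> Num.sg a = Num.sg b.
Proof.
move=> ge0 le0.
have h1 : (0 <= a) = (0 <= b) by apply/idP/idP => /ge0.
have h2 : (a <= 0) = (b <= 0) by rewrite -!oppr_ge0; apply/idP/idP => /le0.
by rewrite !sgr_def !ltNge !eq_le h1 h2.
Qed.

Lemma detC (R : realType) (u v : R * R) : det v u = - det u v.
Proof. by rewrite /det; ring. Qed.

Theorem mainTheorem5 (R : realType) (T : Type) (G : graph T)
  (hcount : countable (vertices G))
  (hfin : forall H : graph T,
     subgraph H G -> finite_set (vertices H) -> circle_graph R H) :
  circle_graph R G.
Proof.
have /pcard_injP[e einj] := hcount.
(* [e] is injective on [vertices G] only; [induced] intersects with this set, which makes the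
   subgraphs finite. Every vertex is in [A n] for all large [n]. *)
pose A n := [set v | (e v < n)%N].
have Hfin n : finite_set (vertices (induced G (A n))).
  rewrite -(eq_finite_set (@inj_card_eq _ _ _ e _)); last first.
    by move=> v w /set_mem[Vv _] /set_mem[Vw _]; apply: einj; exact: mem_set.
  by apply: sub_finite_set (finite_II n) => _ [v [_ vn] <-].
have /choice[P hP] n :=
  (circle_graphP R _).1 (hfin _ (induced_subgraph G (A n)) (Hfin n)).
have [U [Uultra oo_U]] := ultraFilterLemma eventually_filter.
have UF : ProperFilter U := @ultra_proper _ _ Uultra.
pose d n x y := det (P n x) (P n y).
pose le x y := \forall n \near U, 0 <= d n x y.
(* An ultrafilter contains each set or its complement; this yields the totality of [le]. *)
have leN x y : ~ le x y -> \forall n \near U, ~ 0 <= d n x y.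
  by case: (in_ultra_setVsetC [set n | 0 <= d n x y] Uultra).
have [f fP] : exists f : T * bool -> R, forall x y,
    (vertices G `*` setT) x -> (vertices G `*` setT) y -> le x y <-> f x <= f y.
  apply: countable_preorder_embedding.
  - exact: countableX.
  - move=> x y; have [|/leN yx] := pselect (le x y); [by left | right].
    apply: filterS yx => n /negP; rewrite -ltNge => /ltW.
    by rewrite /d [det (P n y) _]detC oppr_ge0.
  - move=> x y z xy yz; rewrite /le; near=> n.
    by apply: (@det_ge0_trans _ _ (P n y)); try apply (hP n).1; near: n.
(* Parameters with first coordinate 1 avoid the pole and turn [det] into the difference
   [f y - f x]. *)
apply/circle_graphP; exists (fun x => (1, f x)); split=> [x|].
  by left; exact: ltr01.
apply: encodes_sg => v w Vv Vw.
(* For fixed [v] and [w] there are only finitely many conditions on [n], each holding on a member of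
   [U], so some [n] meets them all. *)
have [n [[vn wn] sgn]] : exists n, (A n v /\ A n w) /\
    forall b c, Num.sg (d n (v, b) (w, c)) = Num.sg (det (1, f (v, b)) (1, f (w, c))).
  have AU x : \forall n \near U, A n x.
    by apply: oo_U; exact: nbhs_infty_gt.
  apply: (@filter_ex _ U); apply: filterI; first exact: filterI (AU v) (AU w).
  have near_ge0 x y : \forall n \near U, 0 <= d n x y <-> le x y.
    have [xy|nxy] := pselect (le x y); last first.
      by apply: filterS (leN _ _ nxy) => n ?; split.
    by apply: filterS (xy) => n ?; split.
  have near_vw : \forall n \near U, forall b c : bool,
      (0 <= d n (v, b) (w, c) <-> le (v, b) (w, c)) /\
      (0 <= d n (w, c) (v, b) <-> le (w, c) (v, b)).
    apply: filter_forall => b; apply: filter_forall => c.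
    exact: filterI (near_ge0 _ _) (near_ge0 _ _).
  apply: filterS near_vw => n sgn b c; have [h1 h2] := sgn b c.
  have detf x y : det (1, f x) (1, f y) = f y - f x by rewrite /det/=; ring.
  (* Swapping the arguments negates [det], so nonnegativity in both orders determines the sign. *)
  apply: sgr_eq_of_ge0.
    by rewrite h1 detf subr_ge0 fP.
  by rewrite /d -!detC h2 detf subr_ge0 fP.
exists (induced G (A n)), (d n); split=> //.
- exact: (hP n).2.
- by split=> [[]|].
Unshelve. all: by end_near.
Qed.
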